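(* Let $g:U\times X\to X$ be a compactly driven system. (i) There exists a causal mapping $H:\overleftarrow{U}\to\overleftarrow{X}_U$ if and only if $g$ has the unique solution property (USP). In particular, in this case the causal mapping is given by $$H(\overleftarrow{u})=\big(\ldots,h(r^2\overleftarrow{u}),h(r\overleftarrow{u}),h(\overleftarrow{u})\big),\qquad \overleftarrow{u}\in\overleftarrow{U},$$ where $h=\mathit{i}^{-1}\circ\mathcal{E}$, $\mathcal{E}$ is the encoding map, and $\mathit{i}:x\mapsto\{x\}$. (ii) The causal mapping $H$ of (i) (when it exists) is a causal embedding whenever $g(\cdot,x):U\to X$ is invertible (i.e. injective, invertible onto its image) for all $x\in X$.
   Context: A driven system consists of a metric space $(U,d_U)$, a compact metric space $(X,d)$ and a continuous map $g:U\times X\to X$. It is a compactly driven system if in addition $U$ is compact. Write $g_u(x):=g(u,x)$. Let $\overline{U}:=\prod_{i\in\mathbb{Z}}U$ and, for a space $Y$, $\overleftarrow{Y}:=\prod_{i=-\infty}^{-1}Y$, with product topologies. Elements of $\overleftarrow{U}$ are written $\overleftarrow{u}=(\ldots,u_{-2},u_{-1})$. A solution for input $\bar u=\{u_n\}\in\overline{U}$ is a sequence $\{x_n\}_{n\in\mathbb{Z}}$ in $X$ with $x_{n+1}=g(u_n,x_n)$ for all $n\in\mathbb{Z}$. The system $g$ has the unique solution property (USP) if for each $\bar u\in\overline{U}$ there is exactly one solution. The reachable set $X_U\subset X$ is the set of all $x\in X$ such that $x=x_k$ for some $k\in\mathbb{Z}$ and some solution $\{x_n\}$ for some $\bar u\in\overline{U}$;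 it carries the subspace topology. $\overleftarrow{X}_U$ denotes the space of left-infinite solutions, i.e. the set of all $(\ldots,x_{-2},x_{-1})\in\overleftarrow{X}$ that arise as left-infinite segments $(\ldots,x_{k-2},x_{k-1})$, $k\in\mathbb{Z}$, of solutions $\{x_n\}$ for inputs $\bar u\in\overline{U}$, with the topology inherited from the product topology. For $v\in U$, $\sigma_v:\overleftarrow{U}\to\overleftarrow{U}$ is $\sigma_v(\ldots,u_{-2},u_{-1})=(\ldots,u_{-2},u_{-1},v)$, and $\tilde g_v(\ldots,x_{-2},x_{-1})=(\ldots,x_{-2},x_{-1},g(v,x_{-1}))$, which maps $\overleftarrow{X}_U$ to itself. The right shift $r:\overleftarrow{U}\to\overleftarrow{U}$ is $r(\ldots,u_{-2},u_{-1})=(\ldots,u_{-3},u_{-2})$. A causal mapping is a continuous surjective map $H:\overleftarrow{U}\to\overleftarrow{X}_U$ with $\tilde g_v\circ H=H\circ\sigma_v$ for all $v\in U$. A causal embedding is a causal mapping that is a homeomorphism from $\overleftarrow{U}$ onto $\overleftarrow{X}_U$. The encoding map is $\mathcal{E}(\overleftarrow{u}):=\bigcap_{n\ge1}g_{u_{-1}}\circ\cdots\circ g_{u_{-n}}(X)$, a nonempty closed subset of $X$. The system $g$ has the USP if and only if $\mathcal{E}(\overleftarrow{u})$ is a singleton for every $\overleftarrow{u}\in\overleftarrow{U}$, in which case $\mathit{i}^{-1}\circ\mathcal{E}$ sends $\overleftarrow{u}$ to the unique element of $\mathcal{E}(\overleftarrow{u})$. *)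

(* Defs.v *)
From HB Require Import structures.
From mathcomp Require Import all_boot all_order all_algebra.
From mathcomp Require Import all_classical all_reals all_analysis.

Set Implicit Arguments.
Unset Strict Implicit.
Unset Printing Implicit Defensive.

Import GRing.Theory.
Local Open Scope classical_set_scope.
Local Open Scope ring_scope.

(* A left-infinite sequence (..., y_{-2}, y_{-1}) is encoded as y : nat -> Y,
   with y n standing for y_{-(n+1)}; {ptws nat -> Y} carries the product
   topology (a bare arrow type into a uniform space would be given the topology
   of uniform convergence). *)
Notation left_seq Y := {ptws nat -> Y}.

(* (..., y_{-2}, y_{-1}) |-> (..., y_{-2}, y_{-1}, v) *)
Definition append {Y : Type} (y : left_seq Y) (v : Y) : left_seq Y :=
  fun n => if n is m.+1 then y m else v.

Definition extend_input {U : Type} (v : U) (u : left_seq U) : left_seq U :=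
  append u v.

Definition right_shift {U : Type} (u : left_seq U) : left_seq U :=
  fun n => u n.+1.

Section DrivenSystem.
Context {U X : topologicalType} (g : U * X -> X).
Implicit Types u : left_seq U.

Definition solution (u : int -> U) (x : int -> X) : Prop :=
  forall n : int, x (n + 1) = g (u n, x n).

Definition USP : Prop :=
  forall u : int -> U, exists! x : int -> X, solution u x.

Definition left_segment (x : int -> X) (k : int) : left_seq X :=
  fun n => x (k - n.+1%:Z).

(* As a type, [left_solutions] has the topology induced by the inclusion
   [set_val] into [left_seq X]. *)
Definition left_solutions : set (left_seq X) :=
  [set y | exists (u : int -> U) (x : int -> X) (k : int),
     solution u x /\ y = left_segment x k].

(* g~_v, on all left-infinite sequences; it preserves [left_solutions] *)
Definition extend_state (v : U) (x : left_seq X) : left_seq X :=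
  append x (g (v, x 0%N)).

(* g_{u_{-1}} o ... o g_{u_{-n}} *)
Fixpoint iterated_map u (n : nat) (x : X) : X :=
  if n is m.+1 then iterated_map u m (g (u m, x)) else x.

Definition encoding u : set X :=
  \bigcap_(n in [set n | (1 <= n)%N]) (iterated_map u n @` [set: X]).

Definition causal_mapping (H : left_seq U -> left_solutions) : Prop :=
  [/\ continuous H,
      forall y : left_solutions, exists u, H u = y &
      forall (v : U) u,
        set_val (H (extend_input v u)) = extend_state v (set_val (H u))].

Definition causal_embedding (H : left_seq U -> left_solutions) : Prop :=
  causal_mapping H /\
  exists K : left_solutions -> left_seq U,
    [/\ cancel H K, cancel K H & continuous K].

End DrivenSystem.

(* Main.v *)
Require Import Defs.
From mathcomp Require Import all_boot all_order all_algebra.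
From mathcomp Require Import all_classical all_reals all_analysis.
From mathcomp Require Import zify.

Import GRing.Theory.
Local Open Scope classical_set_scope.

(** Everything is governed by one relation between left-infinite sequences:
    [backward_orbit g u x] says that [x] is a state history driven by the input
    history [u], i.e. [x n = g (u n, x n.+1)] for all [n].  A backward orbit
    extends to a two-sided solution by iterating [g] forward from its last
    state, so [left_solutions g] is the set of all backward orbits
    ([left_solutionsP]), and the USP makes the backward orbit of each input
    history unique ([USP_backward_orbit]).  As [X] is compact, [encoding g u]
    consists of the last states of the backward orbits of [u] ([encodingP]), so
    under the USP it is a singleton.

    From USP to a causal mapping: let [H u] be the unique backward orbit of [u].
    The graph of [H] is the relation itself, which is closed because [g] is
    continuous, and the space of state histories is compact by Tychonoff, so [H]
    is continuous by the closed graph theorem [closed_graph_continuous].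

    From a causal mapping to the USP: intertwining the shifts forces [H u] to be
    a backward orbit of [u] ([causal_mapping_orbit]), which gives existence of
    solutions.  For uniqueness, let [x] be any backward orbit of [u].  Since [H]
    is onto, [x = H w] for some input history [w], possibly different from [u].
    Replace the remote past of [u], before time [-n], by that of [w]: the
    resulting input drives the state of [x] at time [-n] along the recent
    entries of [u], so [H] sends it to a history ending in the last state of
    [x].  These inputs converge to [u], hence by continuity [H u] also ends in
    the last state of [x] ([causal_mapping_head]).

    Part (ii): when each [g (., x)] is injective, a backward orbit determines its
    input, so [H] is bijective.  The graph of its inverse is again the relation
    [backward_orbit], read from states to inputs, and the closed graph theorem,
    now with the compact space of input histories as codomain, gives continuity. *)

(** * Left-infinite sequences *)

Lemma iter_right_shiftE {Y : Type} (n m : nat) (y : left_seq Y) :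
  iter n right_shift y m = y (n + m)%N.
Proof.
elim: n m => [//|n IHn] m.
by rewrite iterS /right_shift IHn addnS.
Qed.

Lemma append_right_shift {Y : Type} (y : left_seq Y) :
  append (right_shift y) (y 0%N) = y.
Proof. by apply/funext => -[]. Qed.

Section LeftSequences.
Context {Y : topologicalType}.

Lemma left_seq_proj_continuous (n : nat) :
  continuous (fun y : left_seq Y => y n).
Proof. exact: (@proj_continuous _ (fun=> Y) n). Qed.

Lemma left_seq_cvg {T : Type} {F : set_system T} {FF : Filter F}
    (f : T -> left_seq Y) (y : left_seq Y) :
  (forall n, (fun t => f t n) @ F --> y n) -> f @ F --> y.
Proof.
move=> fy; apply/cvg_sup => n A [_ [[V oV <-] Vy VA]].
by apply: filterS VA _; apply: fy; exact: open_nbhs_nbhs.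
Qed.

Lemma left_seq_compact :
  compact [set: Y] -> compact [set: left_seq Y].
Proof.
move=> Y_compact.
rewrite [X in compact X](_ : _ = [set f | forall i : nat, [set: Y] (f i)]).
  exact: (@tychonoff _ (fun=> Y) (fun=> [set: Y])).
by apply/seteqP; split.
Qed.

End LeftSequences.

(** * Closed relations and continuity *)

Lemma pair_continuous {T Y Z : topologicalType} (f : T -> Y) (h : T -> Z) :
  continuous f -> continuous h -> continuous (fun t => (f t, h t)).
Proof.
by move=> f_cont h_cont t; apply: cvg_pair; [exact: f_cont|exact: h_cont].
Qed.

Lemma closed_equalizer {T Y : topologicalType} (f h : T -> Y) :
  hausdorff_space Y -> continuous f -> continuous h ->
  closed [set t | f t = h t].
Proof.
move=> Y_hausdorff f_cont h_cont t t_clos; apply: Y_hausdorff => A B ftA htB.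
have /t_clos[s [/= fhs [As Bs]]] : nbhs t (f @^-1` A `&` h @^-1` B).
  by apply: filterI; [exact: f_cont|exact: h_cont].
by exists (f s); split=> //; rewrite fhs.
Qed.

(** Let [A] be a neighbourhood of [f t].  Each [y] either equals [f t], and then
    all points near it lie in [A], or [(t, y)] is off the graph, and then so are
    all pairs near it.  Hence [y' = f s -> A y'] holds for [(s, y')] near
    [(t, y)]; compactness makes the neighbourhood of [t] independent of [y]. *)
Lemma closed_graph_continuous {T Y : topologicalType} (f : T -> Y) :
  compact [set: Y] -> closed [set p : T * Y | p.2 = f p.1] -> continuous f.
Proof.
move=> /compact_near_coveringP Y_cover f_closed t A ftA.
have : \forall s \near t, [set: Y] `<=` [set y | y = f s -> A y].
  apply: Y_cover => y _; have [->|yft] := EM (y = f t).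
    exists (A, setT) => /=; first by split=> //; exact: filterT.
    by move=> [z s] /= [Az _].
  have /open_nbhs_nbhs[[V W] /= [Vt Wy] VW] :
      open_nbhs (t, y) (~` [set p : T * Y | p.2 = f p.1]).
    by split; [exact: closed_openC|].
  exists (W, V) => //= -[z s] /= [Wz Vs] zfs.
  by have := VW (s, z) (conj Vs Wz).
by apply: filterS => s; apply.
Qed.

(** * Backward orbits *)

Section Orbits.
Context {U X : topologicalType} (g : U * X -> X).
Implicit Types (u : left_seq U) (x : left_seq X).

Definition backward_orbit u x : Prop := forall n, x n = g (u n, x n.+1).

Lemma driven_continuous {T : topologicalType} (a : T -> U) (b : T -> X) :
  continuous g -> continuous a -> continuous b ->
  continuous (fun t => g (a t, b t)).
Proof.
move=> g_cont a_cont b_cont t.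
apply: (@continuous_comp _ _ _ (fun t => (a t, b t)) g); last exact: g_cont.
exact: pair_continuous.
Qed.

Lemma backward_orbit_closed :
  hausdorff_space X -> continuous g ->
  closed [set p : left_seq U * left_seq X | backward_orbit p.1 p.2].
Proof.
move=> X_hausdorff g_cont.
rewrite (_ : [set _ | _] = \bigcap_(n in [set: nat])
    [set p : left_seq U * left_seq X | p.2 n = g (p.1 n, p.2 n.+1)]); last first.
  by apply/seteqP; split=> [p pO n _|p pO n]; exact: pO.
have coord1 n : continuous (fun p : left_seq U * left_seq X => p.1 n).
  move=> p; apply: (@continuous_comp _ _ _ fst (fun y : left_seq U => y n)).
    exact: cvg_fst.
  exact: left_seq_proj_continuous.
have coord2 n : continuous (fun p : left_seq U * left_seq X => p.2 n).
  move=> p; apply: (@continuous_comp _ _ _ snd (fun y : left_seq X => y n)).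
    exact: cvg_snd.
  exact: left_seq_proj_continuous.
apply: closed_bigI => n _; apply: closed_equalizer => //.
exact: driven_continuous.
Qed.

Lemma backward_orbit_extend u x v :
  backward_orbit u x -> backward_orbit (extend_input v u) (extend_state g v x).
Proof. by move=> ux [|n] //=; exact: ux. Qed.

Lemma iterated_map_eq u v n z :
  (forall i, (i < n)%N -> u i = v i) ->
  iterated_map g u n z = iterated_map g v n z.
Proof.
elim: n z => [//|n IHn] z uv /=.
by rewrite uv // IHn // => i /ltnW; exact: uv.
Qed.

(** The definition of [iterated_map] peels off the innermost map of the
    composition; this peels off the outermost one. *)
Lemma iterated_mapSl u n z :
  iterated_map g u n.+1 z = g (u 0%N, iterated_map g (right_shift u) n z).
Proof. by elim: n z => [//|n IHn] z; rewrite -IHn. Qed.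

Lemma backward_orbit_iterated_map u x n :
  backward_orbit u x -> iterated_map g u n (x n) = x 0%N.
Proof. by move=> ux; elim: n => [//|n IHn] /=; rewrite -ux. Qed.

(** A point of the encoding is reached from arbitrarily far in the past, but a
    priori along unrelated finite orbits; a cluster point of these in the
    compact space of state histories is a single infinite orbit. *)
Lemma encodingP u z :
  compact [set: X] -> hausdorff_space X -> continuous g ->
  encoding g u z <-> exists2 x, backward_orbit u x & x 0%N = z.
Proof.
move=> X_compact X_hausdorff g_cont; split=> [uz|[x ux <-] n _]; last first.
  by exists (x n) => //; exact: backward_orbit_iterated_map.
have /choice[w wE] n : exists w, iterated_map g u n.+1 w = z.
  by have [w _ <-] := uz n.+1 (ltn0Sn n); exists w.
(* The finite orbit from [w n] to [z]; its entries from index [n.+1] on, where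
   the truncated subtraction vanishes, are constantly [w n]. *)
pose approx n : left_seq X :=
  fun i => iterated_map g (iter i right_shift u) (n.+1 - i) (w n).
have approx0 n : approx n 0%N = z by rewrite /approx subn0; exact: wE.
have approxS n i : (i <= n)%N -> approx n i = g (u i, approx n i.+1).
  move=> le_in; rewrite /approx subSS subSn // iterated_mapSl iterS.
  by rewrite iter_right_shiftE addn0.
have [x [_ x_cluster]] :=
  left_seq_compact X_compact (approx @ \oo) _ filterT.
have x_closed (C : set (left_seq X)) :
    closed C -> (\forall n \near \oo, C (approx n)) -> C x.
  by move=> C_closed nC; apply: C_closed => B xB; exact: x_cluster.
exists x => [i|].
  apply: (x_closed [set y | y i = g (u i, y i.+1)]).
    apply: closed_equalizer => //; first exact: left_seq_proj_continuous.
    apply: driven_continuous => //; first exact: cst_continuous.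
    exact: left_seq_proj_continuous.
  by exists i => // n /= le_in; exact: approxS.
apply: (x_closed [set y | y 0%N = z]); last first.
  by apply: nearW => n; exact: approx0.
apply: closed_equalizer => //; first exact: left_seq_proj_continuous.
exact: cst_continuous.
Qed.

(** The two segments are offset by one: the last state [xb k] of the history is
    the one produced by the last input [ub (k - 1)]. *)
Lemma solution_left_segment (ub : int -> U) (xb : int -> X) (k : int) :
  solution g ub xb ->
  backward_orbit (left_segment ub k) (left_segment xb (k + 1)%R).
Proof.
move=> sol n; rewrite /left_segment.
have -> : (k + 1 - n.+1%:Z = (k - n.+1%:Z) + 1)%R by rewrite addrAC.
by rewrite sol; congr (g (_, xb _)); lia.
Qed.

Lemma solution_of_backward_orbit (ub : int -> U) x :
  backward_orbit (left_segment ub 0) x ->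
  exists xb : int -> X, solution g ub xb /\ left_segment xb 1 = x.
Proof.
move=> ux.
(* [Negz m] is [-(m + 1)], so [x] occupies the times up to [0]. *)
pose xb k := match k with
  | Negz m => x m.+1
  | Posz m => iteri m (fun i z => g (ub i, z)) (x 0%N) end.
exists xb; split.
- case=> [m|m]; first by rewrite -PoszD addn1.
  have -> : ub (Negz m) = left_segment ub 0 m.
    by rewrite /left_segment sub0r NegzE.
  rewrite [RHS]/= -ux; case: m => [//|m].
  by have -> : (Negz m.+1 + 1 = Negz m)%R by lia.
- apply/funext => -[|n]; first by rewrite /left_segment subrr.
  by rewrite /left_segment; have -> : (1 - n.+2%:Z = Negz n)%R by lia.
Qed.

Lemma left_segment_surjective u : exists ub : int -> U, left_segment ub 0 = u.
Proof.
(* Any value of [U] may serve as future input, and [u 0] is at hand. *)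
exists (fun k => if k is Negz m then u m else u 0%N).
by apply/funext => n; rewrite /left_segment sub0r -NegzE.
Qed.

Lemma left_solutionsP x : left_solutions g x <-> exists u, backward_orbit u x.
Proof.
split=> [[ub [xb [k [sol ->]]]]|[u]].
  exists (left_segment ub (k - 1)%R).
  by have := solution_left_segment ub xb (k - 1)%R sol; rewrite subrK.
have [ub <-] := left_segment_surjective u.
by move=> /solution_of_backward_orbit[xb [sol <-]]; exists ub, xb, 1%R.
Qed.

Lemma USP_backward_orbit : USP g -> forall u, exists! x, backward_orbit u x.
Proof.
move=> usp u; have [ub ubE] := left_segment_surjective u.
have [xb [sol xb_unique]] := usp ub.
exists (left_segment xb 1); split.
  by rewrite -ubE -[1%R]add0r; exact: solution_left_segment.
move=> x; rewrite -ubE => /solution_of_backward_orbit[yb [soly <-]].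
by rewrite (xb_unique yb soly).
Qed.

End Orbits.

(** * Properties of causal mappings *)

Section CausalMappings.
Context {U X : topologicalType} {g : U * X -> X}.
Context {H : left_seq U -> left_solutions g} (H_causal : causal_mapping H).
Implicit Types (u : left_seq U) (x : left_seq X).

(** Writing [u] as its right shift extended by [u 0], the intertwining relation
    says that [H] commutes with the right shift. *)
Lemma causal_mappingE u n :
  set_val (H u) n = set_val (H (iter n right_shift u)) 0%N.
Proof.
have [_ _ H_extend] := H_causal.
elim: n u => [//|n IHn] u.
rewrite iterSr -IHn -[in LHS](append_right_shift u).
by rewrite -/(extend_input _ _) H_extend.
Qed.

Lemma causal_mapping_orbit u : backward_orbit g u (set_val (H u)).
Proof.
move=> n; rewrite (causal_mappingE u n) (causal_mappingE u n.+1) iterS.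
have [_ _ H_extend] := H_causal.
set v := iter n right_shift u.
have -> : u n = v 0%N by rewrite /v iter_right_shiftE addn0.
by rewrite -[in LHS](append_right_shift v) -/(extend_input _ _) H_extend.
Qed.

(** Surjectivity gives [x = H w], where [w] need not be [u].  Grafting the remote
    past of [w] onto the last [n] entries of [u] yields an input that [H] sends
    to a history ending in [x 0], and as [n] grows these inputs tend to [u]. *)
Lemma causal_mapping_head u x :
  hausdorff_space X -> backward_orbit g u x -> x 0%N = set_val (H u) 0%N.
Proof.
move=> X_hausdorff ux; have [H_cont H_surj _] := H_causal.
have [w wx] : exists w, set_val (H w) = x.
  have x_sol : left_solutions g x by apply/left_solutionsP; exists u.
  have [w wE] := H_surj (exist _ x (mem_set x_sol)).
  by exists w; rewrite wE.
pose splice n : left_seq U := fun i => if (i < n)%N then u i else w i.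
have splice_head n : set_val (H (splice n)) 0%N = x 0%N.
  (* Both sides are images of the state at index [n] under the last [n] inputs;
     that state depends only on the inputs further back, which come from [w]. *)
  rewrite -(backward_orbit_iterated_map g _ _ n (causal_mapping_orbit _)).
  rewrite -(backward_orbit_iterated_map g _ _ n ux) -wx.
  rewrite (causal_mappingE (splice n)) (causal_mappingE w).
  have -> : iter n right_shift (splice n) = iter n right_shift w.
    apply/funext => i; rewrite !iter_right_shiftE /splice.
    by rewrite ltnNge leq_addr.
  by apply: iterated_map_eq => i i_lt; rewrite /splice i_lt.
have splice_cvg : splice @ \oo --> u.
  apply: left_seq_cvg => i; apply: cvg_near_cst.
  by exists i.+1 => // n /= i_lt; rewrite /splice i_lt.
have head_cont : continuous (fun v => set_val (H v) 0%N).
  move=> v; apply: (@continuous_comp _ _ _ H (fun y => set_val y 0%N)).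
    exact: H_cont.
  apply: (@continuous_comp _ _ _ set_val (fun y : left_seq X => y 0%N)).
    exact: initial_continuous.
  exact: left_seq_proj_continuous.
have : (fun n => set_val (H (splice n)) 0%N) @ \oo --> set_val (H u) 0%N.
  exact: (cvg_comp _ _ splice_cvg (head_cont u)).
under eq_fun do rewrite splice_head.
by move=> /(cvg_unique X_hausdorff (cvg_cst _)).
Qed.

Lemma causal_mapping_USP : hausdorff_space X -> USP g.
Proof.
move=> X_hausdorff ub.
exists (fun k => set_val (H (left_segment ub k)) 0%N); split=> [k|xb sol].
  have [_ _ H_extend] := H_causal.
  have -> : left_segment ub (k + 1) = extend_input (ub k) (left_segment ub k).
    apply/funext => -[|n]; rewrite /left_segment ?addrK //=.
    by congr ub; lia.
  by rewrite H_extend.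
apply/funext => k; have := solution_left_segment _ _ _ k sol.
move=> /(causal_mapping_head _ _ X_hausdorff) <-.
by rewrite /left_segment addrK.
Qed.

End CausalMappings.

(** * Existence, uniqueness and invertibility of the causal mapping *)

(** The map sending an input history to its unique backward orbit: its graph is
    the closed relation [backward_orbit]. *)
Lemma USP_causal_mapping {U X : topologicalType} (g : U * X -> X) :
  compact [set: X] -> hausdorff_space X -> continuous g -> USP g ->
  exists H : left_seq U -> left_solutions g, causal_mapping H.
Proof.
move=> X_compact X_hausdorff g_cont usp.
have /choice[orbit orbitP] u :
    exists x, forall y, backward_orbit g u y <-> y = x.
  have [x [ux x_unique]] := USP_backward_orbit g usp u.
  by exists x => y; split=> [/x_unique|->].
have orbit_sol u : left_solutions g (orbit u).
  by apply/left_solutionsP; exists u; exact/orbitP.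
have orbit_cont : continuous (orbit : left_seq U -> left_seq X).
  apply: closed_graph_continuous; first exact: left_seq_compact.
  rewrite (_ : [set _ | _] =
      [set p : left_seq U * left_seq X | backward_orbit g p.1 p.2]).
    exact: backward_orbit_closed.
  by apply/seteqP; split=> -[u x] /orbitP.
exists (fun u => exist _ (orbit u) (mem_set (orbit_sol u))); split.
- exact: continuous_comp_initial.
- move=> [y y_sol]; have /left_solutionsP[u /orbitP yE] := set_mem y_sol.
  by exists u; exact: val_inj.
- by move=> v u; apply/esym/orbitP/backward_orbit_extend/orbitP.
Qed.

Lemma causal_mapping_unique {U X : topologicalType} {g : U * X -> X}
    (H H' : left_seq U -> left_solutions g) :
  USP g -> causal_mapping H -> causal_mapping H' -> H' = H.
Proof.
move=> usp H_causal H'_causal; apply/funext => u; apply: val_inj.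
have [x [_ x_unique]] := USP_backward_orbit g usp u.
rewrite -[LHS](x_unique (set_val (H' u))); last exact: causal_mapping_orbit.
by rewrite -[RHS](x_unique (set_val (H u))); last exact: causal_mapping_orbit.
Qed.

(** An inverse [K] of [H] sends a left-infinite solution to an input driving it.
    Injectivity of [g (., x)] makes that input unique, so the graph of [K] is the
    closed relation [backward_orbit] read backwards. *)
Lemma causal_mapping_embedding {U X : topologicalType} {g : U * X -> X}
    (H : left_seq U -> left_solutions g) :
  compact [set: U] -> hausdorff_space X -> continuous g ->
  (forall x, injective (fun v => g (v, x))) ->
  causal_mapping H -> causal_embedding H.
Proof.
move=> U_compact X_hausdorff g_cont g_inj H_causal; split=> //.
have [_ H_surj _] := H_causal.
have orbit_inj u w x : backward_orbit g u x -> backward_orbit g w x -> u = w.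
  by move=> ux wx; apply/funext => n; apply: (g_inj (x n.+1)); rewrite -ux -wx.
have /choice[K HK] := H_surj.
have K_orbit y : backward_orbit g (K y) (set_val y).
  by rewrite -{2}(HK y); exact: causal_mapping_orbit.
exists K; split=> //.
  move=> u; apply: (orbit_inj _ _ (set_val (H u))); first exact: K_orbit.
  exact: causal_mapping_orbit.
apply: closed_graph_continuous; first exact: left_seq_compact.
rewrite (_ : [set _ | _] =
    (fun p : left_solutions g * left_seq U => (p.2, set_val p.1)) @^-1`
    [set p : left_seq U * left_seq X | backward_orbit g p.1 p.2]).
  apply: preimage_closed; last exact: backward_orbit_closed.
  move=> p _; apply: pair_continuous => {}p; first exact: cvg_snd.
  apply: (@continuous_comp _ _ _ fst set_val); first exact: cvg_fst.
  exact: initial_continuous.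
apply/seteqP; split=> -[y u] /=; first by move=> ->; exact: K_orbit.
by move=> /orbit_inj; apply; exact: K_orbit.
Qed.

Theorem theorem2 (R : realType) (U X : metricType R) (g : U * X -> X)
    (U_compact : compact [set: U]) (X_compact : compact [set: X])
    (g_continuous : continuous g) :
  ((exists H : left_seq U -> left_solutions g, causal_mapping H) <-> USP g) /\
  (USP g ->
    exists (h : left_seq U -> X) (H : left_seq U -> left_solutions g),
      [/\ forall u : left_seq U, [set h u] = encoding g u,
          causal_mapping H,
          forall H' : left_seq U -> left_solutions g,
            causal_mapping H' -> H' = H &
          forall (u : left_seq U) (n : nat),
            set_val (H u) n = h (iter n right_shift u)]) /\
  (forall H : left_seq U -> left_solutions g,
    causal_mapping H ->
    (forall x : X, injective (fun v : U => g (v, x))) ->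
    causal_embedding H).
Proof.
have X_hausdorff : hausdorff_space X by exact: metric_hausdorff.
split; [split=> [[H H_causal]|usp]|split=> [usp|H H_causal g_inj]].
- exact: causal_mapping_USP H_causal X_hausdorff.
- exact: USP_causal_mapping.
- have [H H_causal] := USP_causal_mapping g X_compact X_hausdorff g_continuous usp.
  exists (fun u => set_val (H u) 0%N), H; split=> //.
  + move=> u; apply/seteqP; split=> z.
      move=> ->; apply/encodingP => //.
      by exists (set_val (H u)) => //; exact: causal_mapping_orbit.
    move=> /encodingP[]// x ux <-.
    exact: causal_mapping_head.
  + by move=> H'; exact: causal_mapping_unique.
  + exact: causal_mappingE.
- exact: causal_mapping_embedding.
Qed.
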